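(* Let $(M,g)$ be the Hayward black hole spacetime with parameters $m>0$, $b>0$: coordinates $(t,r,\theta,\phi)$ and $g=-\left(1-\frac{2mr^2}{r^3+2mb^2}\right)dt^2+\left(1-\frac{2mr^2}{r^3+2mb^2}\right)^{-1}dr^2+r^2(d\theta^2+\sin^2\theta\, d\phi^2)$, on the domain $r>0$, $0<\theta<\pi$, $r^3+2mb^2-2mr^2\neq 0$. Let $\xi$ be any of the non-Killing vector fields $\frac{\partial}{\partial r}$, $\frac{\partial}{\partial\theta}$, or $\lambda_1\frac{\partial}{\partial r}+\lambda_2\frac{\partial}{\partial\theta}$ with $\lambda_1,\lambda_2\in\mathbb R$ not both zero. Then with respect to $\xi$ the spacetime $M$ admits (i) neither Ricci collineation nor Ricci inheritance; (ii) neither curvature collineation for the $(1,3)$-type curvature tensor nor curvature collineation for the $(0,4)$-type curvature tensor; (iii) neither curvature inheritance for the $(1,3)$-type curvature tensor nor curvature inheritance for the $(0,4)$-type curvature tensor.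
   Context: Let $S$ be the Ricci tensor, $\widetilde R$ the $(1,3)$-type Riemann curvature tensor and $R$ the corresponding $(0,4)$-type tensor, $R(v_1,v_2,v_3,v_4)=g(\widetilde R(v_1,v_2)v_3,v_4)$. For a vector field $\xi$ on $M$, with $\pounds_\xi$ the Lie derivative: Ricci inheritance means $\pounds_\xi S=\lambda S$ for some scalar function $\lambda$ on $M$, and Ricci collineation means $\pounds_\xi S=0$; curvature inheritance for the $(1,3)$-type (resp. $(0,4)$-type) curvature tensor means $\pounds_\xi\widetilde R=\lambda\widetilde R$ (resp. $\pounds_\xi R=\lambda R$) for some scalar function $\lambda$ on $M$, and curvature collineation means the same with $\lambda=0$. *)

(* Defs.v *)
From HB Require Import structures.
From mathcomp Require Import all_boot all_order all_algebra.
From mathcomp Require Import all_classical all_reals all_analysis.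

Set Implicit Arguments.
Unset Strict Implicit.
Unset Printing Implicit Defensive.

Import Order.TTheory GRing.Theory Num.Theory.
Import numFieldNormedType.Exports.

Local Open Scope classical_set_scope.
Local Open Scope ring_scope.

(* Tensor calculus in one global chart: a point is the row vector of its      *)
(* coordinates, the spacetime is an open set [M] of 'rV[R]_n, and tensor      *)
(* fields are given by their components in the coordinate frame.  Fields are  *)
(* total functions; only their values on [M] matter.                          *)

Definition vector_field (R : realType) (n : nat) : Type :=
  'rV[R]_n -> 'rV[R]_n.

(* [T p a b] is T(d_a, d_b) at p. *)
Definition tensor02 (R : realType) (n : nat) : Type :=
  'rV[R]_n -> 'I_n -> 'I_n -> R.

(* [T p a b c d] is T(d_a, d_b, d_c, d_d) at p. *)
Definition tensor04 (R : realType) (n : nat) : Type :=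
  'rV[R]_n -> 'I_n -> 'I_n -> 'I_n -> 'I_n -> R.

(* [T p a b c d] is the d-th component of T(d_a, d_b)d_c at p: the            *)
(* contravariant index comes last.                                            *)
Definition tensor13 (R : realType) (n : nat) : Type :=
  'rV[R]_n -> 'I_n -> 'I_n -> 'I_n -> 'I_n -> R.

Definition coord_field (R : realType) (n : nat) (i : 'I_n) :
    vector_field R n :=
  fun _ => delta_mx 0 i.

Definition partial (R : realType) (n : nat) (i : 'I_n) (f : 'rV[R]_n -> R)
    (p : 'rV[R]_n) : R :=
  'D_(delta_mx 0 i) f p.

Section Curvature.
Context (R : realType) (n : nat) (g : 'rV[R]_n -> 'M[R]_n).
Implicit Types (p : 'rV[R]_n) (a b c d : 'I_n).

(* [christoffel a b c p] is Gamma^c_{ab}, i.e. the c-th component of the      *)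
(* Levi-Civita derivative of d_b along d_a.                                   *)
Definition christoffel a b c p : R :=
  2^-1 * \sum_e invmx (g p) c e *
    (partial a (fun q => g q b e) p + partial b (fun q => g q a e) p
     - partial e (fun q => g q a b) p).

(* R~(X, Y)Z = nabla_X nabla_Y Z - nabla_Y nabla_X Z - nabla_[X,Y] Z *)
Definition riemann13 : tensor13 R n := fun p a b c d =>
  partial a (christoffel b c d) p - partial b (christoffel a c d) p
  + \sum_e (christoffel b c e p * christoffel a e d p
            - christoffel a c e p * christoffel b e d p).

(* R(v1, v2, v3, v4) = g(R~(v1, v2)v3, v4) *)
Definition riemann04 : tensor04 R n := fun p a b c d =>
  \sum_e riemann13 p a b c e * g p e d.

(* S(Y, Z) = trace (X |-> R~(X, Y)Z) *)
Definition ricci : tensor02 R n := fun p b c =>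
  \sum_a riemann13 p a b c a.

End Curvature.

Section LieDerivative.
Context (R : realType) (n : nat) (X : vector_field R n).
Implicit Types (p : 'rV[R]_n) (a b c d e : 'I_n).

Let dX a e p : R := partial a (fun q => X q 0 e) p.

Definition lie02 (T : tensor02 R n) : tensor02 R n := fun p a b =>
  \sum_e (X p 0 e * partial e (fun q => T q a b) p
          + dX a e p * T p e b + dX b e p * T p a e).

Definition lie04 (T : tensor04 R n) : tensor04 R n := fun p a b c d =>
  \sum_e (X p 0 e * partial e (fun q => T q a b c d) p
          + dX a e p * T p e b c d + dX b e p * T p a e c d
          + dX c e p * T p a b e d + dX d e p * T p a b c e).

Definition lie13 (T : tensor13 R n) : tensor13 R n := fun p a b c d =>
  \sum_e (X p 0 e * partial e (fun q => T q a b c d) p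
          + dX a e p * T p e b c d + dX b e p * T p a e c d
          + dX c e p * T p a b e d - dX e d p * T p a b c e).

End LieDerivative.

Section Symmetries.
Context (R : realType) (n : nat) (M : set 'rV[R]_n) (g : 'rV[R]_n -> 'M[R]_n)
        (xi : vector_field R n).

Definition ricci_collineation : Prop :=
  forall p, M p -> forall a b, lie02 xi (ricci g) p a b = 0.

Definition ricci_inheritance : Prop :=
  exists lambda : 'rV[R]_n -> R,
  forall p, M p -> forall a b,
    lie02 xi (ricci g) p a b = lambda p * ricci g p a b.

Definition curvature13_collineation : Prop :=
  forall p, M p -> forall a b c d, lie13 xi (riemann13 g) p a b c d = 0.

Definition curvature13_inheritance : Prop :=
  exists lambda : 'rV[R]_n -> R,
  forall p, M p -> forall a b c d,
    lie13 xi (riemann13 g) p a b c d = lambda p * riemann13 g p a b c d.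

Definition curvature04_collineation : Prop :=
  forall p, M p -> forall a b c d, lie04 xi (riemann04 g) p a b c d = 0.

Definition curvature04_inheritance : Prop :=
  exists lambda : 'rV[R]_n -> R,
  forall p, M p -> forall a b c d,
    lie04 xi (riemann04 g) p a b c d = lambda p * riemann04 g p a b c d.

End Symmetries.

(* Coordinates (t, r, theta, phi). *)
Definition i_t : 'I_4 := @Ordinal 4 0 isT.
Definition i_r : 'I_4 := @Ordinal 4 1 isT.
Definition i_theta : 'I_4 := @Ordinal 4 2 isT.
Definition i_phi : 'I_4 := @Ordinal 4 3 isT.

Section Hayward.
Context (R : realType) (m b : R).

Definition hayward_f (r : R) : R :=
  1 - (2 * m * r ^+ 2) / (r ^+ 3 + 2 * m * b ^+ 2).

Definition hayward_metric (p : 'rV[R]_4) : 'M[R]_4 :=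
  let r := p 0 i_r in
  let theta := p 0 i_theta in
  diag_mx (\row_(i < 4)
    [:: - hayward_f r; (hayward_f r)^-1;
        r ^+ 2; r ^+ 2 * (sin theta) ^+ 2]`_i).

Definition hayward_domain : set 'rV[R]_4 := [set p : 'rV[R]_4 |
  [/\ 0 < p 0 i_r,
      0 < p 0 i_theta < pi &
      p 0 i_r ^+ 3 + 2 * m * b ^+ 2 - 2 * m * p 0 i_r ^+ 2 != 0]].

End Hayward.

(* Main.v *)
(* Along xi = l1 d_r + l2 d_theta with constant coefficients the Lie derivative
   of a tensor field is taken componentwise.  If a component h depends on r
   only, and h and w h both scale at the same rate lambda, then xi(w) h = 0.
   For any metric - f dt^2 + dr^2 / f + r^2 (dtheta^2 + sin^2 theta dphi^2) each
   of the three tensors has a pair of components with ratio w = sin^2 theta,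
   which forces l2 = 0, and a pair whose ratio w depends on r only (- f^2 for
   the Ricci and the (0,4) curvature tensor, r^2 f for the (1,3) one), which
   forces l1 = 0.  It remains to find a point where these components and the
   derivatives of the ratios do not vanish: theta = pi/4 and r large.  The case
   lambda = 0 disposes of the collineations. *)

Require Import Defs.
From HB Require Import structures.
From mathcomp Require Import all_boot all_order all_algebra.
From mathcomp Require Import all_classical all_reals all_analysis.
From mathcomp Require Import ring lra.

Set Implicit Arguments.
Unset Strict Implicit.
Unset Printing Implicit Defensive.

Import Order.TTheory GRing.Theory Num.Theory.
Import numFieldNormedType.Exports.

Local Open Scope classical_set_scope.
Local Open Scope ring_scope.

(** * Derivatives of functions of one real variable *)

Section DeriveRules.
Context (R : realType).
Implicit Types (u v : R -> R) (x c du dv : R).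

Lemma deriv_cst c x : is_derive x 1 (fun=> c) 0.
Proof. exact: is_derive_cst. Qed.

Lemma deriv_id x : is_derive x 1 (fun y => y) 1.
Proof. exact: is_derive_id. Qed.

Lemma deriv_opp u x du : is_derive x 1 u du ->
  is_derive x 1 (fun y => - u y) (- du).
Proof. exact: is_deriveN. Qed.

Lemma deriv_add u v x du dv : is_derive x 1 u du -> is_derive x 1 v dv ->
  is_derive x 1 (fun y => u y + v y) (du + dv).
Proof. exact: is_deriveD. Qed.

Lemma deriv_mul u v x du dv : is_derive x 1 u du -> is_derive x 1 v dv ->
  is_derive x 1 (fun y => u y * v y) (u x * dv + v x * du).
Proof. exact: is_deriveM. Qed.

Lemma deriv_exp u k x du : is_derive x 1 u du ->
  is_derive x 1 (fun y => u y ^+ k) (k%:R * u x ^+ k.-1 * du).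
Proof. by move=> /(is_deriveX k); rewrite exprfctE. Qed.

Lemma deriv_inv u x du : u x != 0 -> is_derive x 1 u du ->
  is_derive x 1 (fun y => (u y)^-1) (- (u x) ^- 2 * du).
Proof. exact: is_deriveV. Qed.

End DeriveRules.

(** The derivative is an evar filled in from the syntax of the function. Constants are matched
    first, so that they are not decomposed; functions such as [f] are closed by derivative
    hypotheses of the context, and the side conditions of inverses by its nonvanishing
    hypotheses. *)
Ltac deriv_rules :=
  cbv beta;
  lazymatch goal with
  | |- is_derive _ _ (fun _ => ?c) _ => notypeclasses refine (deriv_cst _ _)
  | |- is_derive _ _ (fun y => y) _ => notypeclasses refine (deriv_id _)
  | |- is_derive _ _ (fun y => - @?u y) _ =>
      notypeclasses refine (deriv_opp (u := u) _); deriv_rules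
  | |- is_derive _ _ (fun y => @?u y + @?v y) _ =>
      notypeclasses refine (deriv_add (u := u) (v := v) _ _); deriv_rules
  | |- is_derive _ _ (fun y => @?u y * @?v y) _ =>
      notypeclasses refine (deriv_mul (u := u) (v := v) _ _); deriv_rules
  | |- is_derive _ _ (fun y => (@?u y)^-1) _ =>
      notypeclasses refine (deriv_inv (u := u) _ _);
      [by rewrite ?expf_neq0 ?mulf_neq0 ?pnatr_eq0|deriv_rules]
  | |- is_derive _ _ (fun y => @?u y ^+ ?k) _ =>
      notypeclasses refine (deriv_exp (u := u) _ _); deriv_rules
  | |- _ => first
      [ eassumption
      | notypeclasses refine (is_derive_sin _)
      | notypeclasses refine (is_derive_cos _) ]
  end.

(* [is_derive] is a class, so a plain [apply: is_derive_eq] would let instance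
   resolution choose the derivative. *)
Ltac deriv := notypeclasses refine (is_derive_eq _ _); [deriv_rules|cbv beta].

Ltac deriv_ex :=
  notypeclasses refine (@ex_derive _ _ _ _ _ _ _ _); deriv_rules.

(** * Partial derivatives and the Christoffel symbols of a diagonal metric *)

Section Partial.
Context (R : realType) (n : nat).
Implicit Types (p q : 'rV[R]_n) (i j : 'I_n).

(** Near 0 the difference quotient of [f] along the axis is that of [F]. Only local agreement is
    asked for, so formulas valid on an open domain can be differentiated. *)
Lemma partialE i (f : 'rV[R]_n -> R) (F : R -> R) (D : R) p :
  is_derive (p 0 i) 1 F D ->
  (\forall x \near p 0 i, f (p + (x - p 0 i) *: delta_mx 0 i) = F x) ->
  partial i f p = D.
Proof.
move=> [dF <-] nF; rewrite /partial /derive.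
have F0 : f p = F (p 0 i).
  by have := nbhs_singleton nF; rewrite subrr scale0r addr0.
have near0 : \forall h \near 0^', h^-1 *: (F (h%:A + p 0 i) - F (p 0 i)) =
    h^-1 *: (f (h *: delta_mx 0 i + p) - f p).
  have c0 : (fun h : R => h + p 0 i) @ 0 --> 0 + p 0 i.
    by apply: cvgD; [exact: cvg_id|exact: cvg_cst].
  rewrite add0r in c0.
  have /nbhs_dnbhs := c0 _ nF; apply: filterS => h /=.
  by rewrite addrK => E; rewrite F0 [X in f X]addrC E [h%:A]mulr1.
(* Eventually equal quotients define the same image filter, hence the same limit. *)
rewrite /derive; congr (lim _).
by rewrite eqEsubset; split; apply/near_eq_cvg => //; apply: filterS near0 => h.
Qed.

Lemma partial_cst i (c : R) p : partial i (cst c) p = 0.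
Proof. by rewrite /partial derive_cst. Qed.

(** The inverse metric is diagonal, so only [e = c] survives in the sum; the boolean multiples are
    Kronecker deltas. *)
Lemma christoffel_diag (d : 'I_n -> 'rV[R]_n -> R) p :
  (forall i, d i p != 0) ->
  forall a b c, christoffel (fun q => diag_mx (\row_i d i q)) a b c p =
    (2 * d c p)^-1 * (partial a (d c) p *+ (b == c)
      + partial b (d c) p *+ (a == c) - partial c (d a) p *+ (a == b)).
Proof.
move=> d0 a b c.
have inv : invmx (diag_mx (\row_i d i p)) = diag_mx (\row_i (d i p)^-1).
  have E : diag_mx (\row_i (d i p)^-1) *m diag_mx (\row_i d i p) = 1%:M.
    rewrite mul_diag_mx; apply/matrixP => i j; rewrite !mxE.
    by case: eqVneq => [->|_]; rewrite ?mulr1n ?mulr0n ?mulr0// mulVf.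
  have [_ U] := mulmx1_unit E.
  by rewrite -[RHS]mulmx1 -(mulmxV U) mulmxA E mul1mx.
have dE i j k : partial i (fun q => diag_mx (\row_i d i q) j k) p
    = partial i (d j) p *+ (j == k).
  case: eqVneq => [<-|jk].
    by congr (partial _ _ p); apply/funext => q; rewrite !mxE eqxx.
  rewrite mulr0n -[RHS](partial_cst i 0 p); congr (partial _ _ p).
  by apply/funext => q; rewrite !mxE (negbTE jk).
rewrite /christoffel inv (bigD1 c)//= big1 => [|e ec]; last first.
  by rewrite !mxE eq_sym (negbTE ec) mul0r.
rewrite addr0 !mxE eqxx mulr1n mulrA -invfM !dE.
(* Where a delta is 1, the [d b] or [d a] that it multiplies is [d c]. *)
by case: (eqVneq b c) => [->|]; case: (eqVneq a c) => [->|].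
Qed.

End Partial.

(** * Curvature of a static spherically symmetric metric with profile [f] *)

Section StaticMetric.
Context (R : realType) (f f1 f2 : R -> R) (A : set R).
Hypotheses (A_open : open A) (A_neq0 : forall x, A x -> x != 0)
  (f_neq0 : forall x, A x -> f x != 0)
  (fd : forall x, A x -> is_derive x 1 f (f1 x))
  (f1d : forall x, A x -> is_derive x 1 f1 (f2 x)).
Implicit Types (p q : 'rV[R]_4) (a b c d i : 'I_4).

Definition static_entry (i : 'I_4) (r t : R) : R :=
  [:: - f r; (f r)^-1; r ^+ 2; r ^+ 2 * sin t ^+ 2]`_i.

Definition static_metric (p : 'rV[R]_4) : 'M[R]_4 :=
  diag_mx (\row_(i < 4) static_entry i (p 0 i_r) (p 0 i_theta)).

(** The angular condition is exactly what keeps the last metric entry nonzero, once the radius is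
    nonzero. *)
Definition static_domain : set 'rV[R]_4 :=
  [set p | A (p 0 i_r) /\ sin (p 0 i_theta) != 0].
Local Notation M := static_domain.
Local Notation g := static_metric.

Lemma static_entry_neq0 p i : M p ->
  static_entry i (p 0 i_r) (p 0 i_theta) != 0.
Proof.
move=> [Ap sp]; move: (A_neq0 Ap) (f_neq0 Ap) => r0 fr0.
by case: i => [[|[|[|[|//]]]] ?];
  rewrite /static_entry /= ?oppr_eq0 ?invr_eq0 ?mulf_neq0 ?expf_neq0.
Qed.

(** Both conditions are open, and each involves one coordinate: a move along an axis affects at most
    one of them. *)
Lemma static_domain_near p i : M p ->
  \forall x \near p 0 i, M (p + (x - p 0 i) *: delta_mx 0 i).
Proof.
move=> [Ap sp].
have nA : \forall x \near p 0 i_r, A x by exact: A_open.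
have ns : \forall x \near p 0 i_theta, sin x != 0.
  apply: (@continuous_sin R (p 0 i_theta) [set y | y != 0]).
  by apply: open_nbhs_nbhs; split => //; exact: open_neq.
case: (eqVneq i i_r) nA => [->|ir] nA.
  move: nA; apply: filterS => x Ax; split;
    rewrite !mxE /= ?mulr1 ?mulr0 ?addr0//.
  by rewrite addrC subrK.
case: (eqVneq i i_theta) ns => [->|it] ns.
  move: ns; apply: filterS => x Ax; split;
    rewrite !mxE /= ?mulr1 ?mulr0 ?addr0//.
  by rewrite addrC subrK.
apply: filterE => x; split.
  by rewrite !mxE eqxx/= eq_sym (negbTE ir) mulr0 addr0.
by rewrite !mxE eqxx/= [i_theta == i]eq_sym (negbTE it) mulr0 addr0.
Qed.

Section OnDomain.
Context (h : 'rV[R]_4 -> R) (H : R -> R -> R) (p : 'rV[R]_4).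
Hypotheses (Mp : M p) (hE : forall q, M q -> h q = H (q 0 i_r) (q 0 i_theta)).

Lemma partial_rE D :
  is_derive (p 0 i_r) 1 (H^~ (p 0 i_theta)) D -> partial i_r h p = D.
Proof.
move=> dH; apply: partialE dH _;
  apply: filterS (static_domain_near i_r Mp) => x Mx.
by rewrite hE// !mxE /= mulr1 mulr0 addr0 addrC subrK.
Qed.

Lemma partial_thetaE D :
  is_derive (p 0 i_theta) 1 (H (p 0 i_r)) D -> partial i_theta h p = D.
Proof.
move=> dH; apply: partialE dH _;
  apply: filterS (static_domain_near i_theta Mp) => x Mx.
by rewrite hE// !mxE /= mulr1 mulr0 addr0 addrC subrK.
Qed.

Lemma partial_cyclic i : i != i_r -> i != i_theta -> partial i h p = 0.
Proof.
move=> ir it; apply: partialE (is_derive_cst (h p) _ _) _.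
apply: filterS (static_domain_near i Mp) => x Mx.
rewrite [RHS]hE// hE// !mxE eqxx/= ![_ == i]eq_sym (negbTE ir) (negbTE it).
by rewrite !mulr0 !addr0.
Qed.

End OnDomain.

Definition static_dentry (j i : 'I_4) (r t : R) : R :=
  match val j, val i with
  | 1%N, 0%N => - f1 r
  | 1%N, 1%N => - f1 r / f r ^+ 2
  | 1%N, 2%N => 2 * r
  | 1%N, 3%N => 2 * r * sin t ^+ 2
  | 2%N, 3%N => 2 * r ^+ 2 * sin t * cos t
  | _, _ => 0
  end.

Lemma partial_entry p j i : M p ->
  partial j (fun q => static_entry i (q 0 i_r) (q 0 i_theta)) p
    = static_dentry j i (p 0 i_r) (p 0 i_theta).
Proof.
move=> Mp; have [Ap sp] := Mp; have r0 := A_neq0 Ap; have fr0 := f_neq0 Ap.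
have fdp := fd Ap.
case: j => [[|[|[|[|//]]]] jP].
- by apply: partial_cyclic.
- apply: partial_rE => //; case: i => [[|[|[|[|//]]]] iP];
    rewrite /static_entry /static_dentry /=.
  + by deriv; ring.
  + by deriv; field.
  + by deriv; ring.
  + by deriv; ring.
- apply: partial_thetaE => //; case: i => [[|[|[|[|//]]]] iP];
    rewrite /static_entry /static_dentry /=.
  + by deriv; ring.
  + by deriv; field.
  + by deriv; ring.
  + by deriv; ring.
- by apply: partial_cyclic.
Qed.

(** The upper index [c] comes last, and the numerals 0 to 3 stand for t, r, theta, phi. *)
Definition static_christoffel (a b c : 'I_4) (r t : R) : R :=
  match val a, val b, val c with
  | 0%N, 0%N, 1%N => f r * f1 r / 2
  | 0%N, 1%N, 0%N | 1%N, 0%N, 0%N => f1 r / (2 * f r)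
  | 1%N, 1%N, 1%N => - f1 r / (2 * f r)
  | 1%N, 2%N, 2%N | 2%N, 1%N, 2%N | 1%N, 3%N, 3%N | 3%N, 1%N, 3%N => r^-1
  | 2%N, 2%N, 1%N => - (r * f r)
  | 3%N, 3%N, 1%N => - (r * f r * sin t ^+ 2)
  | 3%N, 3%N, 2%N => - (sin t * cos t)
  | 2%N, 3%N, 3%N | 3%N, 2%N, 3%N => cos t / sin t
  | _, _, _ => 0
  end.

Lemma static_christoffelE p a b c : M p ->
  christoffel g a b c p = static_christoffel a b c (p 0 i_r) (p 0 i_theta).
Proof.
move=> Mp; have [Ap sp] := Mp; have r0 := A_neq0 Ap; have fr0 := f_neq0 Ap.
rewrite christoffel_diag; last by move=> i; exact: static_entry_neq0.
rewrite !partial_entry//.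
case: a => [[|[|[|[|//]]]] aP]; case: b => [[|[|[|[|//]]]] bP];
  case: c => [[|[|[|[|//]]]] cP];
  rewrite /static_entry /static_dentry /static_christoffel /=;
  rewrite ?eqE /= ?mulr0n ?mulr1n.
all: try by ring.
all: try by field; rewrite ?r0 ?fr0 ?sp.
Qed.

(** Here [i] is the direction of differentiation. The derivative of the cotangent is written as -(1
    + cot^2), which [field] checks without the Pythagorean identity. *)
Definition static_dchristoffel (i a b c : 'I_4) (r t : R) : R :=
  match val i, val a, val b, val c with
  | 1%N, 0%N, 0%N, 1%N => (f1 r ^+ 2 + f r * f2 r) / 2
  | 1%N, 0%N, 1%N, 0%N | 1%N, 1%N, 0%N, 0%N =>
      (f2 r * f r - f1 r ^+ 2) / (2 * f r ^+ 2)
  | 1%N, 1%N, 1%N, 1%N => (f1 r ^+ 2 - f2 r * f r) / (2 * f r ^+ 2)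
  | 1%N, 1%N, 2%N, 2%N | 1%N, 2%N, 1%N, 2%N
  | 1%N, 1%N, 3%N, 3%N | 1%N, 3%N, 1%N, 3%N => - r ^- 2
  | 1%N, 2%N, 2%N, 1%N => - (f r + r * f1 r)
  | 1%N, 3%N, 3%N, 1%N => - ((f r + r * f1 r) * sin t ^+ 2)
  | 2%N, 3%N, 3%N, 1%N => - (2 * r * f r * sin t * cos t)
  | 2%N, 3%N, 3%N, 2%N => sin t ^+ 2 - cos t ^+ 2
  | 2%N, 2%N, 3%N, 3%N | 2%N, 3%N, 2%N, 3%N => - (1 + cos t ^+ 2 / sin t ^+ 2)
  | _, _, _, _ => 0
  end.

Lemma partial_christoffel p i a b c : M p ->
  partial i (christoffel g a b c) p
    = static_dchristoffel i a b c (p 0 i_r) (p 0 i_theta).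
Proof.
move=> Mp; have [Ap sp] := Mp; have r0 := A_neq0 Ap; have fr0 := f_neq0 Ap.
have fdp := fd Ap; have f1dp := f1d Ap.
(* The formula for the symbols holds throughout the open domain, so it may be differentiated at
   [p]. *)
have hE q : M q -> _ := @static_christoffelE q a b c.
case: i => [[|[|[|[|//]]]] iP].
{ by rewrite (partial_cyclic Mp hE). }
{ apply: (partial_rE Mp hE); move: a b c {hE} => [[|[|[|[|//]]]] aP]
    [[|[|[|[|//]]]] bP] [[|[|[|[|//]]]] cP];
  rewrite /static_christoffel /static_dchristoffel /=.
  all: try by exact: deriv_cst.
  all: deriv.
  all: try by ring.
  all: try by field. }
{ apply: (partial_thetaE Mp hE); move: a b c {hE} => [[|[|[|[|//]]]] aP]
    [[|[|[|[|//]]]] bP] [[|[|[|[|//]]]] cP];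
  rewrite /static_christoffel /static_dchristoffel /=.
  all: try by exact: deriv_cst.
  all: deriv.
  all: try by ring.
  all: try by field. }
{ by rewrite (partial_cyclic Mp hE). }
Qed.

(* The component of R(d_a, d_b)d_b along d_a. *)
Definition static_curvature (a b : 'I_4) (r t : R) : R :=
  match val a, val b with
  | 1%N, 0%N => f r * f2 r / 2
  | 0%N, 1%N => - f2 r / (2 * f r)
  | 2%N, 0%N | 3%N, 0%N => f r * f1 r / (2 * r)
  | 2%N, 1%N | 3%N, 1%N => - f1 r / (2 * r * f r)
  | 0%N, 2%N | 1%N, 2%N => - (r * f1 r) / 2
  | 3%N, 2%N => 1 - f r
  | 0%N, 3%N | 1%N, 3%N => sin t ^+ 2 * (- (r * f1 r) / 2)
  | 2%N, 3%N => sin t ^+ 2 * (1 - f r)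
  | _, _ => 0
  end.

(** These components suffice: they sum to the diagonal of the Ricci tensor, and one metric factor
    turns each into a (0,4) component. *)
Lemma static_riemann13E p a b : M p ->
  riemann13 g p a b b a = static_curvature a b (p 0 i_r) (p 0 i_theta).
Proof.
move=> Mp; have [Ap sp] := Mp; have r0 := A_neq0 Ap; have fr0 := f_neq0 Ap.
rewrite /riemann13 !partial_christoffel// 4!big_ord_recl big_ord0
  !static_christoffelE//.
case: a => [[|[|[|[|//]]]] aP]; case: b => [[|[|[|[|//]]]] bP];
  rewrite /static_christoffel /static_dchristoffel /static_curvature /= /bump
    /=.
all: try by ring.
all: try by field; rewrite ?r0 ?fr0 ?sp.
Qed.

Lemma static_ricciE p b : M p ->
  ricci g p b b = \sum_a static_curvature a b (p 0 i_r) (p 0 i_theta).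
Proof. by move=> Mp; apply: eq_bigr => a _; rewrite static_riemann13E. Qed.

Lemma static_riemann04E p a b : M p ->
  riemann04 g p a b b a = static_curvature a b (p 0 i_r) (p 0 i_theta)
                          * static_entry a (p 0 i_r) (p 0 i_theta).
Proof.
move=> Mp; rewrite /riemann04 (bigD1 a)//= big1 => [|e ea].
  by rewrite addr0 static_riemann13E// !mxE eqxx mulr1n.
by rewrite !mxE (negbTE ea) mulr0n mulr0.
Qed.

(** * Lie derivatives along fields with constant coefficients *)

Section ConstantField.
Context (l1 l2 : R).

(** The common form of the three kinds of field: the coordinate fields are the coefficient pairs (1,
    0) and (0, 1). *)
Definition rtheta_field : vector_field R 4 :=
  fun p => l1 *: coord_field i_r p + l2 *: coord_field i_theta p.

Definition along (h : 'rV[R]_4 -> R) (p : 'rV[R]_4) : R :=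
  l1 * partial i_r h p + l2 * partial i_theta h p.

Lemma partial_rtheta_field i e p :
  partial i (fun q => rtheta_field q 0 e) p = 0.
Proof. exact: (partial_cst i (rtheta_field p 0 e)). Qed.

Lemma sum_rtheta_field p (F : 'I_4 -> R) :
  \sum_e rtheta_field p 0 e * F e = l1 * F i_r + l2 * F i_theta.
Proof.
rewrite (bigD1 i_r)// (bigD1 i_theta)//= big1 => [|e /andP[er et]].
  by rewrite !mxE /= !mulr0 !mulr1 addr0 add0r addr0.
by rewrite !mxE (negbTE er) (negbTE et) !mulr0 addr0 mul0r.
Qed.

Lemma lie02_rtheta (T : tensor02 R 4) p a b :
  lie02 rtheta_field T p a b = along (fun q => T q a b) p.
Proof.
rewrite /along -(sum_rtheta_field p (fun e => partial e (fun q => T q a b) p));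
  apply: eq_bigr => e _.
by rewrite !partial_rtheta_field !mul0r !addr0.
Qed.

Lemma lie04_rtheta (T : tensor04 R 4) p a b c d :
  lie04 rtheta_field T p a b c d = along (fun q => T q a b c d) p.
Proof.
rewrite /along -(sum_rtheta_field p (fun e => partial e (fun q => T q a b c d)
  p)); apply: eq_bigr => e _.
by rewrite !partial_rtheta_field !mul0r !addr0.
Qed.

Lemma lie13_rtheta (T : tensor13 R 4) p a b c d :
  lie13 rtheta_field T p a b c d = along (fun q => T q a b c d) p.
Proof.
rewrite /along -(sum_rtheta_field p (fun e => partial e (fun q => T q a b c d)
  p)); apply: eq_bigr => e _.
by rewrite !partial_rtheta_field !mul0r !addr0 subr0.
Qed.

(** * Two components that scale at the same rate *)

Section Rate.
Context (p : 'rV[R]_4) (lambda : R) (h k : 'rV[R]_4 -> R) (phi : R -> R).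
Hypotheses (Mp : M p) (phi_neq0 : phi (p 0 i_r) != 0)
  (phid : derivable phi (p 0 i_r) 1)
  (hE : forall q, M q -> h q = phi (q 0 i_r))
  (h_rate : along h p = lambda * h p) (k_rate : along k p = lambda * k p).

Let dphi := 'D_1 phi (p 0 i_r).

Let phi_is_derive : is_derive (p 0 i_r) 1 phi dphi.
Proof. exact: derivableP. Qed.

Let h_rate_phi : l1 * dphi = lambda * phi (p 0 i_r).
Proof.
move: h_rate;
  rewrite /along (partial_rE Mp (H := fun r _ => phi r) hE phi_is_derive).
by rewrite (partial_thetaE Mp (H := fun r _ => phi r) hE (deriv_cst _ _)) mulr0
  addr0 hE.
Qed.

(** Subtracting sin^2 theta times the rate equation of [h] from that of [k] leaves [l2] times the
    theta derivative of sin^2 theta times [phi]. That derivative vanishes on the equator, whence the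
    condition on the cosine. *)
Lemma rate_theta : cos (p 0 i_theta) != 0 ->
  (forall q, M q -> k q = sin (q 0 i_theta) ^+ 2 * phi (q 0 i_r)) -> l2 = 0.
Proof.
move=> c0 kE; have [_ s0] := Mp.
move: k_rate; rewrite /along kE//.
have -> : partial i_r k p = sin (p 0 i_theta) ^+ 2 * dphi.
  apply: (partial_rE Mp (H := fun r t => sin t ^+ 2 * phi r) kE).
  by deriv; ring.
have -> : partial i_theta k p = 2 * sin (p 0 i_theta) * cos (p 0 i_theta) * phi
  (p 0 i_r).
  apply: (partial_thetaE Mp (H := fun r t => sin t ^+ 2 * phi r) kE).
  by deriv; ring.
set s := sin _; set c := cos _; move=> E.
have {E} : l2 * (2 * s * c * phi (p 0 i_r)) = 0.
  apply: (addrI (s ^+ 2 * (l1 * dphi))); rewrite [in RHS]h_rate_phi.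
  by rewrite addr0 [RHS]mulrCA -E; ring.
move/eqP; rewrite mulf_eq0 => /orP[/eqP //|].
by rewrite !mulf_eq0 pnatr_eq0 (negbTE s0) (negbTE c0) (negbTE phi_neq0).
Qed.

(** The same subtraction, now with factor [w], leaves [l1] times [dw] times [phi]. *)
Lemma rate_r (w : R -> R) (dw : R) : is_derive (p 0 i_r) 1 w dw -> dw != 0 ->
  (forall q, M q -> k q = w (q 0 i_r) * phi (q 0 i_r)) -> l1 = 0.
Proof.
move=> wd dw0 kE; move: k_rate; rewrite /along kE//.
have -> : partial i_r k p = w (p 0 i_r) * dphi + dw * phi (p 0 i_r).
  apply: (partial_rE Mp (H := fun r _ => w r * phi r) kE).
  by deriv; ring.
rewrite (partial_thetaE Mp (H := fun r _ => w r * phi r) kE (deriv_cst _ _)).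
move=> E; have {E} : l1 * (dw * phi (p 0 i_r)) = 0.
  apply: (addrI (w (p 0 i_r) * (l1 * dphi))); rewrite [in RHS]h_rate_phi.
  by rewrite addr0 [RHS]mulrCA -E; ring.
move/eqP; rewrite mulf_eq0 => /orP[/eqP //|].
by rewrite mulf_eq0 (negbTE dw0) (negbTE phi_neq0).
Qed.

End Rate.

(** * Pointwise criteria for the three tensors *)

Section AtPoint.
Context (p : 'rV[R]_4) (lambda : R).
Hypotheses (Mp : M p) (cos_neq0 : cos (p 0 i_theta) != 0)
  (f1_neq0 : f1 (p 0 i_r) != 0).
Local Notation r := (p 0 i_r).

Let f_derive : is_derive r 1 f (f1 r).
Proof. by apply: fd; case: Mp. Qed.

Let f1_derive : is_derive r 1 f1 (f2 r).
Proof. by apply: f1d; case: Mp. Qed.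

Let fr_neq0 : f r != 0. Proof. by case: Mp => /f_neq0. Qed.

Let r_neq0 : r != 0. Proof. by case: Mp => /A_neq0. Qed.

(** The function - f^2 is the quotient of the tt and rr metric entries. *)
Let dfsqr : is_derive r 1 (fun x => - f x ^+ 2) (- (2 * f r * f1 r)).
Proof. by deriv; ring. Qed.

Let dfsqr_neq0 : - (2 * f r * f1 r) != 0.
Proof. by rewrite oppr_eq0 !mulf_neq0 ?pnatr_eq0. Qed.

(** The rr component contains [f2], so its Lie derivative needs a third derivative of the profile.
    The two inequalities make the theta-theta and rr components nonzero at [p]. *)
Lemma static_ricci_rate : derivable f2 r 1 ->
  1 - f r - r * f1 r != 0 -> f2 r / 2 + f1 r / r != 0 ->
  (forall a b, lie02 rtheta_field (ricci g) p a b = lambda * ricci g p a b) ->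
  l1 = 0 /\ l2 = 0.
Proof.
move=> /derivableP f2_derive S22 S11 rate; split.
  apply: (@rate_r p lambda (fun q => ricci g q i_r i_r)
    (fun q => ricci g q i_t i_t) (fun x => - (f2 x / 2 + f1 x / x) / f x)
    Mp _ _ _ _ _ (fun x => - f x ^+ 2) _ dfsqr dfsqr_neq0).
  - by rewrite mulf_neq0 ?oppr_eq0 ?invr_eq0.
  - deriv_ex.
  - move=> q Mq; have [/[dup] /A_neq0 q0 /f_neq0 fq0 _] := Mq;
      rewrite static_ricciE// 4!big_ord_recl big_ord0 /static_curvature /=
      /bump/=.
    by field; rewrite fq0 q0.
  - by rewrite -lie02_rtheta rate.
  - by rewrite -lie02_rtheta rate.
  - move=> q Mq; have [/[dup] /A_neq0 q0 /f_neq0 fq0 _] := Mq;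
      rewrite static_ricciE// 4!big_ord_recl big_ord0 /static_curvature /=
      /bump/=.
    by field; rewrite fq0 q0.
apply: (@rate_theta p lambda (fun q => ricci g q i_theta i_theta)
    (fun q => ricci g q i_phi i_phi) (fun x => 1 - f x - x * f1 x) Mp) => //.
- deriv_ex.
- move=> q Mq;
    rewrite static_ricciE// 4!big_ord_recl big_ord0 /static_curvature /=
    /bump/=.
  by field.
- by rewrite -lie02_rtheta rate.
- by rewrite -lie02_rtheta rate.
- move=> q Mq;
    rewrite static_ricciE// 4!big_ord_recl big_ord0 /static_curvature /=
    /bump/=.
  by field.
Qed.

Let phi13_neq0 : - (r * f1 r) / 2 != 0.
Proof. by rewrite !mulf_neq0 ?oppr_eq0 ?mulf_neq0 ?invr_eq0 ?pnatr_eq0. Qed.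

(** Raising the last index cancels the factor - f^2: the components of R(d_t, d_theta)d_theta along
    d_t and of R(d_r, d_theta)d_theta along d_r are equal. By pair symmetry, exchanging r and theta
    gives instead the ratio of the theta-theta and rr metric entries, r^2 f. *)
Lemma static_riemann13_rate : 2 * f r + r * f1 r != 0 ->
  (forall a b c d, lie13 rtheta_field (riemann13 g) p a b c d
                   = lambda * riemann13 g p a b c d) ->
  l1 = 0 /\ l2 = 0.
Proof.
move=> w0 rate; split.
  have dw : is_derive r 1 (fun x => x ^+ 2 * f x) (r * (2 * f r + r * f1 r)).
    by deriv; ring.
  apply: (@rate_r p lambda (fun q => riemann13 g q i_theta i_r i_r i_theta)
    (fun q => riemann13 g q i_r i_theta i_theta i_r)
    (fun x => - f1 x / (2 * x * f x)) Mp _ _ _ _ _ _ _ dw).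
  - by rewrite !mulf_neq0 ?oppr_eq0 ?invr_eq0 ?mulf_neq0 ?pnatr_eq0.
  - deriv_ex.
  - by move=> q Mq; rewrite static_riemann13E.
  - by rewrite -lie13_rtheta rate.
  - by rewrite -lie13_rtheta rate.
  - by rewrite mulf_neq0.
  - move=> q Mq; have [/[dup] /A_neq0 q0 /f_neq0 fq0 _] := Mq.
    by rewrite static_riemann13E// /static_curvature /=; field; rewrite fq0 q0.
apply: (@rate_theta p lambda (fun q => riemann13 g q i_r i_theta i_theta i_r)
    (fun q => riemann13 g q i_r i_phi i_phi i_r) (fun x => - (x * f1 x) / 2)
    Mp) => //.
- deriv_ex.
- by move=> q Mq; rewrite static_riemann13E.
- by rewrite -lie13_rtheta rate.
- by rewrite -lie13_rtheta rate.
- by move=> q Mq; rewrite static_riemann13E.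
Qed.

Lemma static_riemann04_rate :
  (forall a b c d, lie04 rtheta_field (riemann04 g) p a b c d
                   = lambda * riemann04 g p a b c d) ->
  l1 = 0 /\ l2 = 0.
Proof.
move=> rate; pose phi x := - (x * f1 x) / 2 / f x.
have phi0 : phi r != 0 by rewrite /phi mulf_neq0 ?invr_eq0.
have phid : derivable phi r 1 by rewrite /phi; deriv_ex.
have hE q : M q -> riemann04 g q i_r i_theta i_theta i_r = phi (q 0 i_r).
  by move=> Mq; rewrite static_riemann04E.
split.
  apply: (@rate_r p lambda _ (fun q => riemann04 g q i_t i_theta i_theta i_t)
    phi Mp phi0 phid hE _ _ _ _ dfsqr dfsqr_neq0).
  - by rewrite -lie04_rtheta rate.
  - by rewrite -lie04_rtheta rate.
  - move=> q Mq; have [/[dup] /A_neq0 q0 /f_neq0 fq0 _] := Mq.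
    by rewrite static_riemann04E// /static_curvature /static_entry /phi /=;
      field; rewrite fq0.
apply: (@rate_theta p lambda _ (fun q => riemann04 g q i_r i_phi i_phi i_r) phi
    Mp phi0 phid hE) => //.
- by rewrite -lie04_rtheta rate.
- by rewrite -lie04_rtheta rate.
- by move=> q Mq;
    rewrite static_riemann04E// /static_curvature /static_entry /phi /= -!mulrA.
Qed.

End AtPoint.
End ConstantField.
End StaticMetric.

(** * The Hayward profile, its derivatives and its signs at large radii *)

Section HaywardProfile.
Context (R : realType) (m b : R).
Hypotheses (m_gt0 : 0 < m) (b_gt0 : 0 < b).
Implicit Types x : R.

Local Notation c := (2 * m * b ^+ 2).
Local Notation u x := (x ^+ 3 + c).

Definition hayward_f1 x : R := 2 * m * x * (x ^+ 3 - 2 * c) / u x ^+ 2.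

Definition hayward_f2 x : R :=
  4 * m * (7 * c * x ^+ 3 - x ^+ 6 - c ^+ 2) / u x ^+ 3.

Definition hayward_radii : set R :=
  [set x | 0 < x /\ u x - 2 * m * x ^+ 2 != 0].

Lemma hayward_c_gt0 : 0 < c.
Proof. by rewrite !mulr_gt0 ?exprn_gt0. Qed.

Lemma hayward_u_neq0 x : 0 < x -> u x != 0.
Proof. by move=> x0; rewrite gt_eqF// addr_gt0 ?exprn_gt0 ?hayward_c_gt0. Qed.

Lemma hayward_radii_open : open hayward_radii.
Proof.
apply: openI; first exact: open_gt.
apply: (@open_comp _ _ (fun x => u x - 2 * m * x ^+ 2) [set y | y != 0]).
  move=> x _; apply: differentiable_continuous; apply/derivable1_diffP.
  by deriv_ex.
exact: open_neq.
Qed.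

Lemma hayward_fE x : 0 < x -> hayward_f m b x = (u x - 2 * m * x ^+ 2) / u x.
Proof. by move=> /hayward_u_neq0 u0; rewrite /hayward_f; field. Qed.

Lemma hayward_f_neq0 x : hayward_radii x -> hayward_f m b x != 0.
Proof.
by move=> [x0 q0]; rewrite hayward_fE// mulf_neq0// invr_eq0 hayward_u_neq0.
Qed.

Lemma hayward_f_derive x : hayward_radii x ->
  is_derive x 1 (hayward_f m b) (hayward_f1 x).
Proof.
move=> [x0 _]; have u0 := hayward_u_neq0 x0.
by rewrite /hayward_f /hayward_f1; deriv; field.
Qed.

Lemma hayward_f1_derive x : hayward_radii x ->
  is_derive x 1 hayward_f1 (hayward_f2 x).
Proof.
move=> [x0 _]; have u0 := hayward_u_neq0 x0.
by rewrite /hayward_f2 /hayward_f1; deriv; field.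
Qed.

Lemma hayward_f2_derivable x : 0 < x -> derivable hayward_f2 x 1.
Proof.
move=> x0; have u0 := hayward_u_neq0 x0.
by rewrite /hayward_f2; deriv_ex.
Qed.

(** This is the theta-theta Ricci component. Its factor [c] would vanish for b = 0, the Ricci-flat
    Schwarzschild case. *)
Lemma hayward_sphere_ricci x : 0 < x ->
  1 - hayward_f m b x - x * hayward_f1 x = 6 * m * c * x ^+ 2 / u x ^+ 2.
Proof.
by move=> /hayward_u_neq0 u0; rewrite /hayward_f /hayward_f1; field.
Qed.

(** This is the rr Ricci component times -f. It vanishes where 2 x^3 = c, a radius to be avoided. *)
Lemma hayward_radial_ricci x : 0 < x ->
  hayward_f2 x / 2 + hayward_f1 x / x = 6 * m * c * (2 * x ^+ 3 - c) / u x ^+ 3.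
Proof.
move=> x0; have u0 := hayward_u_neq0 x0; have xn := lt0r_neq0 x0.
by rewrite /hayward_f1 /hayward_f2; field; rewrite u0 xn.
Qed.

(** The bound combines three: x > 2m makes [f] positive, and x > 2c together with x >= 1 gives x^3 >
    2c, which makes [hayward_f1] positive and puts 2 x^3 above c. *)
Lemma hayward_large x : 1 + 2 * m + 2 * c <= x ->
  [/\ hayward_radii x, 0 < hayward_f m b x, 0 < hayward_f1 x
    & c < 2 * x ^+ 3].
Proof.
move=> x1; have c0 := hayward_c_gt0.
have m0 := m_gt0.
have [x_ge1 x_gt2m x_gt2c] : [/\ 1 <= x, 2 * m < x & 2 * c < x] by split; lra.
have x0 : 0 < x by lra.
have x3 : x <= x ^+ 3 by rewrite -[leLHS]expr1 ler_weXn2l.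
have q0 : 0 < u x - 2 * m * x ^+ 2.
  have -> : u x - 2 * m * x ^+ 2 = x ^+ 2 * (x - 2 * m) + c by ring.
  by rewrite addr_gt0// mulr_gt0 ?exprn_gt0// subr_gt0.
have u0 : 0 < u x by rewrite addr_gt0 ?exprn_gt0.
have x3c : 2 * c < x ^+ 3 by exact: lt_le_trans x_gt2c x3.
split; last by lra.
- by split=> //; rewrite gt_eqF.
- by rewrite hayward_fE// divr_gt0.
- by rewrite divr_gt0 ?exprn_gt0// !mulr_gt0// subr_gt0.
Qed.

End HaywardProfile.

(** * Evaluation of the criteria at one point *)

Theorem mainTheorem8 (R : realType) (m b : R) (hm : 0 < m) (hb : 0 < b)
  (xi : vector_field R 4)
  (hxi : [\/ xi = coord_field i_r,
             xi = coord_field i_theta |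
             exists lambda1 lambda2 : R,
               ~ (lambda1 = 0 /\ lambda2 = 0) /\
               xi = (fun p => lambda1 *: coord_field i_r p
                              + lambda2 *: coord_field i_theta p)]) :
  let M := hayward_domain m b in
  let g := hayward_metric m b in
  [/\ ~ ricci_collineation M g xi /\ ~ ricci_inheritance M g xi,
      ~ curvature13_collineation M g xi /\ ~ curvature04_collineation M g xi &
      ~ curvature13_inheritance M g xi /\ ~ curvature04_inheritance M g xi].
Proof.
move=> M g.
have [l1 [l2 [l0 xiE]]] : exists l1 l2 : R,
    ~ (l1 = 0 /\ l2 = 0) /\ xi = rtheta_field l1 l2.
  case: hxi => [->|->|[l1 [l2 [l0 ->]]]]; last by exists l1, l2.
    exists 1, 0; split; first by case=> /eqP; rewrite oner_eq0.
    by apply/funext => p; rewrite /rtheta_field scale1r scale0r addr0.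
  exists 0, 1; split; first by case=> _ /eqP; rewrite oner_eq0.
  by apply/funext => p; rewrite /rtheta_field scale1r scale0r add0r.
have gE : g = static_metric (hayward_f m b) by [].
have oA := hayward_radii_open (m := m) (b := b).
have A0 x : hayward_radii m b x -> x != 0 by case=> /lt0r_neq0.
have f0 := hayward_f_neq0 hm hb.
have fd := hayward_f_derive hm hb; have f1d := hayward_f1_derive hm hb.
pose x := 1 + 2 * m + 2 * (2 * m * b ^+ 2).
have [Ax fx f1x cx] := hayward_large hm hb (lexx x).
have x0 : 0 < x by case: Ax.
have u0 := hayward_u_neq0 hm hb x0; have c0 := hayward_c_gt0 hm hb.
(* At theta = pi/4 both sine and cosine are nonzero; the values of t and phi are arbitrary. *)
pose p : 'rV[R]_4 := \row_(i < 4) [:: 0; x; pi / 4; 0]`_i.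
have pr : p 0 i_r = x by rewrite mxE.
have pt : p 0 i_theta = pi / 4 by rewrite mxE.
have pi0 := pi_gt0 R.
have Mp : M p.
  by rewrite /M /hayward_domain /= pr pt; case: Ax => _ ?; split=> //; lra.
have Sp : static_domain (hayward_radii m b) p.
  by split; rewrite ?pr// pt gt_eqF// sin_gt0_pi//; lra.
have cp : cos (p 0 i_theta) != 0.
  by rewrite pt gt_eqF// cos_gt0_pihalf//; lra.
have f1p : hayward_f1 m b (p 0 i_r) != 0 by rewrite pr gt_eqF.
have noS : ~ ricci_inheritance M g xi.
  (* The function [lambda] enters only through its value at [p], so no regularity of it is
     involved. *)
  case=> lambda /(_ p Mp); rewrite xiE gE => rate; apply: l0.
  apply: (static_ricci_rate oA A0 f0 fd f1d Sp cp f1p _ _ _ rate); rewrite pr.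
  - exact: hayward_f2_derivable.
  - by rewrite hayward_sphere_ricci// gt_eqF// divr_gt0 ?mulr_gt0 ?exprn_gt0//
      ?addr_gt0 ?exprn_gt0.
  - rewrite hayward_radial_ricci// gt_eqF// divr_gt0 ?exprn_gt0 ?addr_gt0
      ?exprn_gt0//.
    by rewrite !mulr_gt0//; lra.
have no13 : ~ curvature13_inheritance M g xi.
  case=> lambda /(_ p Mp); rewrite xiE gE => rate; apply: l0.
  apply: (static_riemann13_rate oA A0 f0 fd f1d Sp cp f1p _ rate).
  (* The derivative of r^2 f is r (2 f + r f'), and both summands are positive at this radius. *)
  by rewrite pr; apply/lt0r_neq0/addr_gt0; exact: mulr_gt0.
have no04 : ~ curvature04_inheritance M g xi.
  case=> lambda /(_ p Mp); rewrite xiE gE => rate; apply: l0.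
  exact: (static_riemann04_rate oA A0 f0 fd f1d Sp cp f1p rate).
split; split=> // col.
- by apply: noS; exists (fun=> 0) => q Mq i j; rewrite mul0r col.
- by apply: no13; exists (fun=> 0) => q Mq i j k l; rewrite mul0r col.
- by apply: no04; exists (fun=> 0) => q Mq i j k l; rewrite mul0r col.
Qed.
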